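(* There exists an algorithm with time complexity $O(n^2)$ that, given as input a graph $G$ with $n$ vertices and $m$ edges, where $p:=\lfloor\frac{1}{2}+\sqrt{\frac{1}{4}+n^2-n-2m}\rfloor$, and an integer $k \geq 0$ with $p \geq 2k+1$, returns an induced subgraph $G_{p,k}$ of $G$ with $n_0 \leq p+2k+1$ vertices such that $\alpha(G) \leq p-k$ if and only if $\alpha(G_{p,k}) \leq p-k$.
   Context: Graphs are finite and simple. $\alpha(G)$ denotes the independence number of $G$ (maximum size of a set of pairwise non-adjacent vertices). The subgraph returned is constructed as follows: let $H$ be the subgraph of $G$ induced by all vertices of degree at least $n-p+k$, and $G_{p,k}=G-H$ (the subgraph induced by the remaining vertices); $n_0$ denotes the number of vertices of $G_{p,k}$. *)

(* Defs.v *)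
From HB Require Import structures.
From mathcomp Require Import all_boot all_order all_algebra.
From mathcomp Require Import all_classical all_reals all_analysis.

Set Implicit Arguments.
Unset Strict Implicit.
Unset Printing Implicit Defensive.

Import Order.TTheory GRing.Theory Num.Theory.
Import numFieldNormedType.Exports.

Local Open Scope nat_scope.

Record sgraph (T : finType) := SGraph {
  adj :> rel T;
  adj_sym : symmetric adj;
  adj_irrefl : irreflexive adj
}.

Definition nvertices (T : finType) (G : sgraph T) : nat := #|T|.

Definition edges (T : finType) (G : sgraph T) : {set {set T}} :=
  [set e : {set T} | [exists x, exists y, (e == [set x; y]) && adj G x y]].

Definition degree (T : finType) (G : sgraph T) (v : T) : nat :=
  #|[set w | adj G v w]|.

Definition independent (T : finType) (G : sgraph T) (S : {set T}) : bool :=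
  [forall x in S, forall y in S, ~~ adj G x y].

Definition alpha (T : finType) (G : sgraph T) : nat :=
  \max_(S : {set T} | independent G S) #|S|.

Lemma induced_sym (T : finType) (G : sgraph T) (S : {set T}) :
  symmetric (fun x y : {v : T | v \in S} => adj G (val x) (val y)).
Proof. by move=> x y; exact: adj_sym. Qed.

Lemma induced_irrefl (T : finType) (G : sgraph T) (S : {set T}) :
  irreflexive (fun x y : {v : T | v \in S} => adj G (val x) (val y)).
Proof. by move=> x; exact: adj_irrefl. Qed.

Definition induced (T : finType) (G : sgraph T) (S : {set T}) :
  sgraph {v : T | v \in S} :=
  SGraph (@induced_sym T G S) (@induced_irrefl T G S).

(* [Num.truncn] is the floor on nonnegative reals, valued in [nat].  For a
   simple graph, n^2 - n - 2m >= 0, so its argument is at least 1/2. *)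
Definition p_of (R : realType) (T : finType) (G : sgraph T) : nat :=
  Num.truncn (1 / 2 + Num.sqrt
    (1 / 4 + (nvertices G)%:R ^+ 2 - (nvertices G)%:R - 2 * #|edges G|%:R) : R)%R.

(* The threshold is computed in [int], as n - p can be negative (n = 0). *)
Definition high_degree (T : finType) (G : sgraph T) (p k : nat) : {set T} :=
  [set v | ((nvertices G)%:Z - p%:Z + k%:Z <= (degree G v)%:Z)%R].

Definition low_degree (T : finType) (G : sgraph T) (p k : nat) : {set T} :=
  ~: high_degree G p k.

Definition Gpk (T : finType) (G : sgraph T) (p k : nat) :=
  induced G (low_degree G p k).

(* Random access machine under the uniform cost criterion: a store of
   registers, an indirectly addressed memory, and structured programs.  A
   program mentions only finitely many registers.  As usual for this
   criterion, the only arithmetic instructions are addition and (truncated)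
   subtraction.  Every instruction and every test of a guard costs one time
   unit. *)
Record state := State { reg : nat -> nat; ram : nat -> nat }.

Definition upd (f : nat -> nat) (a v : nat) : nat -> nat :=
  fun b => if b == a then v else f b.

Definition set_reg (s : state) (x v : nat) := State (upd (reg s) x v) (ram s).
Definition set_ram (s : state) (a v : nat) := State (reg s) (upd (ram s) a v).

Inductive prog :=
| Const of nat & nat         (* Const x c : x := c *)
| Add of nat & nat & nat     (* Add x y z : x := y + z *)
| Sub of nat & nat & nat     (* Sub x y z : x := y - z *)
| Read of nat & nat          (* Read x y  : x := ram[y] *)
| Write of nat & nat         (* Write x y : ram[x] := y *)
| Seq of prog & prog
| IfLt of nat & nat & prog & prog   (* if x < y *)
| WhileLt of nat & nat & prog.      (* while x < y *)

(* [exec c s t s'] : from state [s], [c] halts in state [s'] after exactly [t]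
   time units. *)
Inductive exec : prog -> state -> nat -> state -> Prop :=
| ExecConst x c s : exec (Const x c) s 1 (set_reg s x c)
| ExecAdd x y z s : exec (Add x y z) s 1 (set_reg s x (reg s y + reg s z))
| ExecSub x y z s : exec (Sub x y z) s 1 (set_reg s x (reg s y - reg s z))
| ExecRead x y s : exec (Read x y) s 1 (set_reg s x (ram s (reg s y)))
| ExecWrite x y s : exec (Write x y) s 1 (set_ram s (reg s x) (reg s y))
| ExecSeq c1 c2 s t1 s1 t2 s2 :
    exec c1 s t1 s1 -> exec c2 s1 t2 s2 -> exec (Seq c1 c2) s (t1 + t2) s2
| ExecIfTrue x y c1 c2 s t s' :
    reg s x < reg s y -> exec c1 s t s' -> exec (IfLt x y c1 c2) s t.+1 s'
| ExecIfFalse x y c1 c2 s t s' :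
    reg s y <= reg s x -> exec c2 s t s' -> exec (IfLt x y c1 c2) s t.+1 s'
| ExecWhileFalse x y c s :
    reg s y <= reg s x -> exec (WhileLt x y c) s 1 s
| ExecWhileTrue x y c s t1 s1 t2 s2 :
    reg s x < reg s y -> exec c s t1 s1 -> exec (WhileLt x y c) s1 t2 s2 ->
    exec (WhileLt x y c) s (t1 + t2).+1 s2.

Lemma exec_det c s t1 s1 t2 s2 :
  exec c s t1 s1 -> exec c s t2 s2 -> t1 = t2 /\ s1 = s2.
Proof.
move=> H; elim: H t2 s2 => {c s t1 s1}; intros;
  match goal with h : exec _ _ ?t ?u |- _ = ?t /\ _ = ?u =>
    inversion h; clear h; subst end;
  repeat match goal with
  | IH : (forall t s, exec ?c ?a t s -> _), h : exec ?c ?a _ _ |- _ =>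
      case: (IH _ _ h) => ? ?; clear IH; subst
  end; try done;
  by match goal with lt : is_true (?a < ?b), ge : is_true (?b <= ?a) |- _ =>
       move: ge; rewrite leqNgt lt end.
Qed.

(* Input: n in register 0, k in register 1, the n x n adjacency matrix stored
   row by row from address 0; all other cells are 0. *)
Definition input_state (n : nat) (G : sgraph 'I_n) (k : nat) : state :=
  State (fun x => if x == 0 then n else if x == 1 then k else 0)
        (fun a => [exists i : 'I_n, exists j : 'I_n,
                     (a == i * n + j) && adj G i j] : nat).

(* Output: the subgraph of G induced by S, given by its number of vertices in
   register 0, a list of its vertices at the address held in register 1, and
   its adjacency matrix, rows and columns in the order of that list, at the
   address held in register 2. *)
Definition returns_induced (n : nat) (s : state) (G : sgraph 'I_n)
    (S : {set 'I_n}) : Prop :=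
  exists vs : seq 'I_n,
    [/\ uniq vs, vs =i S, reg s 0 = size vs,
        forall (v0 : 'I_n) (i : nat), i < size vs ->
          ram s (reg s 1 + i) = nth v0 vs i
      & forall (v0 : 'I_n) (i j : nat), i < size vs -> j < size vs ->
          ram s (reg s 2 + (i * size vs + j))
            = adj G (nth v0 vs i) (nth v0 vs j)].

(* Main.v *)
Require Import Defs.
From HB Require Import structures.
From mathcomp Require Import all_boot all_order all_algebra.
From mathcomp Require Import all_classical all_reals all_analysis.
From mathcomp Require Import zify lra.
Import Order.TTheory GRing.Theory Num.Theory.
Import numFieldNormedType.Exports.

(* The number p is the largest integer with p(p-1) <= d, where
   d = n^2 - n - 2m is the sum of the codegrees n - 1 - deg v.  A vertex of
   low degree has codegree at least p - k, so n_0 (p - k) <= d < p(p+1), which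
   contradicts n_0 >= p + 2k + 2 because
   (p + 2k + 2)(p - k) = p(p+1) + (k+1)(p - 2k).  A vertex of an independent
   set with more than p - k elements has codegree at least p - k, so such a set
   lies in G_{p,k}.
   The machine scans the matrix for 2m, finds p by increasing a counter, which
   stays at most n + 1, scans the matrix again to list the vertices of low
   degree, and copies the rows and columns of these vertices. *)

Local Open Scope nat_scope.

(** * Programs and running time *)

Local Notation Sub := Defs.Sub.
Local Arguments upd f a v b /.

(** The postcondition receives the time as well, so one triple gives termination, correctness and
    cost; nesting postconditions executes a program symbolically from its first instruction. *)
Definition runs (c : prog) (s : state) (Q : nat -> state -> Prop) : Prop :=
  exists t s', exec c s t s' /\ Q t s'.

Lemma runs_const x c s (Q : nat -> state -> Prop) :
  Q 1 (set_reg s x c) -> runs (Const x c) s Q.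
Proof. by move=> h; do 2!eexists; split; [exact: ExecConst|]. Qed.

Lemma runs_add x y z s (Q : nat -> state -> Prop) :
  Q 1 (set_reg s x (reg s y + reg s z)) -> runs (Add x y z) s Q.
Proof. by move=> h; do 2!eexists; split; [exact: ExecAdd|]. Qed.

Lemma runs_sub x y z s (Q : nat -> state -> Prop) :
  Q 1 (set_reg s x (reg s y - reg s z)) -> runs (Sub x y z) s Q.
Proof. by move=> h; do 2!eexists; split; [exact: ExecSub|]. Qed.

Lemma runs_read x y s (Q : nat -> state -> Prop) :
  Q 1 (set_reg s x (ram s (reg s y))) -> runs (Read x y) s Q.
Proof. by move=> h; do 2!eexists; split; [exact: ExecRead|]. Qed.

Lemma runs_write x y s (Q : nat -> state -> Prop) :
  Q 1 (set_ram s (reg s x) (reg s y)) -> runs (Write x y) s Q.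
Proof. by move=> h; do 2!eexists; split; [exact: ExecWrite|]. Qed.

Lemma runs_seq c1 c2 s (Q : nat -> state -> Prop) :
  runs c1 s (fun t1 s1 => runs c2 s1 (fun t2 s2 => Q (t1 + t2) s2)) ->
  runs (Seq c1 c2) s Q.
Proof.
move=> [t1 [s1 [e1 [t2 [s2 [e2 q]]]]]].
by exists (t1 + t2), s2; split=> //; exact: ExecSeq e1 e2.
Qed.

Lemma runs_if x y c1 c2 s (Q : nat -> state -> Prop) :
  (if reg s x < reg s y then runs c1 s (fun t => Q t.+1)
   else runs c2 s (fun t => Q t.+1)) ->
  runs (IfLt x y c1 c2) s Q.
Proof.
case: ltnP => h [t [s' [e q]]]; exists t.+1, s'; split=> //.
- exact: ExecIfTrue.
- exact: ExecIfFalse.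
Qed.

(** The invariant is indexed by the number of passes made, and a true guard must force this index
    below [N], which gives termination. A pass costs at most [b] plus one for its test; the failing
    test adds the last unit. *)
Lemma runs_while (Inv : nat -> state -> Prop) N b x y c s
    (Q : nat -> state -> Prop) :
  Inv 0 s ->
  (forall i s1, Inv i s1 -> reg s1 x < reg s1 y ->
     i < N /\ runs c s1 (fun t s2 => t <= b /\ Inv i.+1 s2)) ->
  (forall i t s1, i <= N -> t <= N * b.+1 + 1 -> Inv i s1 ->
     reg s1 y <= reg s1 x -> Q t s1) ->
  runs (WhileLt x y c) s Q.
Proof.
move=> inv0 step stop.
(* The claim is generalised to start from any pass [i]; [d] bounds the passes left and carries the
   induction. *)
suff loop d i s1 : i <= N -> N - i <= d -> Inv i s1 ->
    exists t s2, exec (WhileLt x y c) s1 t s2 /\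
      [/\ t <= (N - i) * b.+1 + 1, exists2 j, j <= N & Inv j s2
        & reg s2 y <= reg s2 x].
  have [t [s2 [e [le_t [j le_jN inv] ge]]]] := loop N 0 s isT (leq_subr _ _) inv0.
  by exists t, s2; split=> //; apply: (stop j) => //; rewrite subn0 in le_t.
elim: d i s1 => [|d IHd] i s1 le_iN le_d inv;
  case: (ltnP (reg s1 x) (reg s1 y)) => h.
- by have [lt_iN _] := step _ _ inv h; move: le_d; rewrite leqNgt subn_gt0 lt_iN.
- exists 1, s1; split; first exact: ExecWhileFalse.
  by split; rewrite ?addn1//; exists i.
- have [lt_iN [t1 [s2 [e1 [le_t1 inv1]]]]] := step _ _ inv h.
  have [//||t2 [s3 [e2 [le_t2 inv2 ge2]]]] := IHd i.+1 s2 _ _ inv1; first by lia.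
  exists (t1 + t2).+1, s3; split; first exact: ExecWhileTrue e1 e2.
  split=> //; rewrite (_ : N - i = (N - i.+1).+1); last by lia.
  by rewrite mulSn; lia.
- exists 1, s1; split; first exact: ExecWhileFalse.
  by split; rewrite ?addn1//; exists i.
Qed.

(** Frame condition: [l] lists the registers that may change; memory is described by separate
    clauses. *)
Definition agree_off (l : seq nat) (s s' : state) : Prop :=
  forall x, x \notin l -> reg s' x = reg s x.

Lemma agree_set_reg l s s' x v :
  x \in l -> agree_off l s s' -> agree_off l s (set_reg s' x v).
Proof.
move=> xl a y yl; rewrite /set_reg /upd /=; case: eqP => [yx|_]; last exact: a.
by rewrite -yx (negPf yl) in xl.
Qed.

Lemma agree_set_ram l s s' a v :
  agree_off l s s' -> agree_off l s (set_ram s' a v).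
Proof. by []. Qed.

Lemma agree_trans l l' s s' s'' :
  {subset l' <= l} -> agree_off l s s' -> agree_off l' s' s'' ->
  agree_off l s s''.
Proof.
move=> sub a a' x xl; rewrite a' ?a //.
by apply: contra xl; exact: sub.
Qed.

(* The registers 0, 1 and 2 hold n, k and 0 on entry and carry the output on
   exit; rZero is never written.  Read the others as: index of a row or a column
   (rI, rJ), scan address (rA), degree (rD), sum of the degrees (rTot), codegree
   sum plus one (rE), p and p(p+1) (rP, rS), degree threshold (rThr), next
   address to write (rW), addresses of the vertex list and of the row offsets
   (rList, rOff), offset of the current row (rB). *)
Local Notation rN := 0 (only parsing).
Local Notation rK := 1 (only parsing).
Local Notation rOut := 2 (only parsing).
Local Notation rZero := 3 (only parsing).
Local Notation rOne := 4 (only parsing).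
Local Notation rI := 5 (only parsing).
Local Notation rJ := 6 (only parsing).
Local Notation rA := 7 (only parsing).
Local Notation rD := 8 (only parsing).
Local Notation rV := 9 (only parsing).
Local Notation rTot := 10 (only parsing).
Local Notation rE := 11 (only parsing).
Local Notation rP := 12 (only parsing).
Local Notation rS := 13 (only parsing).
Local Notation rList := 14 (only parsing).
Local Notation rW := 15 (only parsing).
Local Notation rB := 16 (only parsing).
Local Notation rThr := 17 (only parsing).
Local Notation rCnt := 18 (only parsing).
Local Notation rOff := 19 (only parsing).
Local Notation rX := 20 (only parsing).

Local Notation "c1 ;; c2" := (Seq c1 c2) (at level 60, right associativity).

Ltac step := first
  [ apply: runs_seq | apply: runs_const | apply: runs_add | apply: runs_sub
  | apply: runs_read | apply: runs_write ]; simpl.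

Ltac agree :=
  repeat match goal with
  | |- agree_off _ _ (set_reg _ _ _) => apply: agree_set_reg; first by []
  | |- agree_off _ _ (set_ram _ _ _) => apply: agree_set_ram
  end; by [].

(** * The kernelization program *)

(** [rA] is not reset, so consecutive calls read consecutive rows without computing a product. *)
Definition row_sum : prog :=
  Const rD 0 ;; Const rJ 0 ;;
  WhileLt rJ rN
    (Read rV rA ;; Add rD rD rV ;; Add rA rA rOne ;; Add rJ rJ rOne).

Lemma row_sum_spec n s (Q : nat -> state -> Prop) :
  reg s rN = n -> reg s rOne = 1 ->
  (forall t s', t <= 5 * n + 3 ->
     agree_off [:: rD; rJ; rV; rA] s s' -> ram s' = ram s ->
     reg s' rA = reg s rA + n ->
     reg s' rD = \sum_(0 <= j < n) ram s (reg s rA + j) -> Q t s') ->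
  runs row_sum s Q.
Proof.
move=> rn r1 post; do 4!step.
apply: (runs_while (fun i s1 => [/\ agree_off [:: rD; rJ; rV; rA] s s1,
   ram s1 = ram s, reg s1 rA = reg s rA + i, reg s1 rJ = i &
   reg s1 rD = \sum_(0 <= j < i) ram s (reg s rA + j)]) n 4).
- by split=> //=; [agree | rewrite addn0 | rewrite big_geq].
- move=> i s1 [a m ra rj rd]; rewrite rj (a rN) // rn => lt_in; split=> //.
  do 7!step; split=> //; split=> //=.
  + agree.
  + by rewrite ra (a rOne) // r1 addn1 addnS.
  + by rewrite rj (a rOne) // r1 addn1.
  + by rewrite big_nat_recr //= rd m ra.
- move=> i t s1 le_in le_t [a m ra rj rd]; rewrite rj (a rN) // rn => le_ni.
  have eq_in : i = n by apply/eqP; rewrite eqn_leq le_in.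
  by apply: post; rewrite -?eq_in//; lia.
Qed.

Definition degree_sum : prog :=
  WhileLt rI rN (row_sum ;; Add rTot rTot rD ;; Add rI rI rOne).

Lemma degree_sum_spec n s (Q : nat -> state -> Prop) :
  reg s rN = n -> reg s rOne = 1 -> reg s rA = 0 -> reg s rI = 0 ->
  reg s rTot = 0 ->
  (forall t s', t <= n * (5 * n + 6) + 1 ->
     agree_off [:: rD; rJ; rV; rA; rTot; rI] s s' -> ram s' = ram s ->
     reg s' rA = n * n ->
     reg s' rTot = \sum_(0 <= i < n) \sum_(0 <= j < n) ram s (i * n + j) ->
     Q t s') ->
  runs degree_sum s Q.
Proof.
move=> rn r1 ra0 ri0 rt0 post.
apply: (runs_while (fun i s1 =>
   [/\ agree_off [:: rD; rJ; rV; rA; rTot; rI] s s1,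
   ram s1 = ram s, reg s1 rA = i * n, reg s1 rI = i &
   reg s1 rTot = \sum_(0 <= i' < i) \sum_(0 <= j < n) ram s (i' * n + j)])
   n (5 * n + 5)).
- by split=> //=; rewrite big_geq.
- move=> i s1 [a m ra ri rt]; rewrite ri (a rN) // rn => lt_in; split=> //.
  step; apply: (row_sum_spec n); [by rewrite a|by rewrite a|].
  move=> t s2 le_t a2 m2 ra2 rd2.
  do 3!step; split; first by lia.
  split=> //=.
  + by do 2!(apply: agree_set_reg; first by []); apply: agree_trans a a2; apply/allP.
  + by rewrite m2.
  + by rewrite ra2 ra mulSn addnC.
  + by rewrite !a2 // (a rOne) // r1 ri addn1.
  + by rewrite big_nat_recr //= a2 // rt rd2 m ra.
- move=> i t s1 le_in le_t [a m ra ri rt]; rewrite ri (a rN) // rn => le_ni.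
  have eq_in : i = n by apply/eqP; rewrite eqn_leq le_in.
  by apply: post => //; [lia | rewrite ra eq_in | rewrite rt eq_in].
Qed.

(** [rS] keeps the value p(p+1), and adding the new p twice is the step from p(p+1) to (p+1)(p+2).
    Since [rE] is d + 1, the strict guard tests p(p+1) <= d. *)
Definition find_p : prog :=
  Sub rE rA rN ;; Sub rE rE rTot ;; Add rE rE rOne ;;
  WhileLt rS rE (Add rP rP rOne ;; Add rS rS rP ;; Add rS rS rP).

Lemma find_p_spec n s (Q : nat -> state -> Prop) :
  reg s rN = n -> reg s rOne = 1 -> reg s rA = n * n ->
  reg s rP = 0 -> reg s rS = 0 ->
  (forall t s' p, t <= 4 * n + 8 ->
     agree_off [:: rE; rP; rS] s s' -> ram s' = ram s ->
     reg s' rP = p -> 0 < p ->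
     p * p.-1 <= n * n - n - reg s rTot < p * p.+1 -> Q t s') ->
  runs find_p s Q.
Proof.
move=> rn r1 ra rp0 rs0 post; do 6!step; rewrite ra rn r1 addn1.
set d := n * n - n - reg s rTot.
have le_d : d <= n * n - n by exact: leq_subr.
apply: (runs_while (fun i s1 => [/\ agree_off [:: rE; rP; rS] s s1,
   ram s1 = ram s, reg s1 rE = d.+1 /\ reg s1 rP = i, reg s1 rS = i * i.+1 &
   i * i.-1 <= d]) n.+1 3).
- by split=> //=; agree.
- move=> i s1 [a m [re rp] rs le_id]; rewrite rs re => lt_id; split.
    (* A true guard means i(i+1) <= d <= n^2 - n, which is impossible once i exceeds n. *)
    by rewrite ltnNge; apply/negP => lt_ni; nia.
  do 5!step; split=> //; split=> //=; first agree.
  + by rewrite rp (a rOne) // r1 addn1.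
  + by rewrite rs rp (a rOne) // r1; lia.
  + by lia.
- move=> i t s1 _ le_t [a m [re rp] rs le_id]; rewrite rs re => lt_di.
  apply: (post _ _ i) => //; first by lia.
  (* At i = 0 the guard holds, because 0 < d + 1, so the loop cannot stop there. *)
  + by case: (i) lt_di.
  + by rewrite -/d le_id lt_di.
Qed.

(** The condition degree < n - p + k with p moved to the left, as truncated subtraction would spoil
    it; [thr] will be n + k. *)
Definition low_rows (mat : nat -> nat) n p thr i : seq nat :=
  [seq v <- iota 0 i | \sum_(0 <= j < n) mat (v * n + j) + p < thr].

Lemma low_rowsS mat n p thr i :
  low_rows mat n p thr i.+1 =
  low_rows mat n p thr i ++
  (if \sum_(0 <= j < n) mat (i * n + j) + p < thr then [:: i] else [::]).
Proof. by rewrite /low_rows -addn1 iotaD filter_cat. Qed.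

Lemma size_low_rows mat n p thr i : size (low_rows mat n p thr i) <= i.
Proof. by rewrite -[leqRHS](size_iota 0) size_filter count_size. Qed.

(* Next to the vertex v at address n^2 + c, the offset v * n of its row is
   stored at address n^2 + n + c: the machine cannot multiply. *)
Definition collect_low : prog :=
  WhileLt rI rN
    (Add rB rA rZero ;; row_sum ;; Add rD rD rP ;;
     IfLt rD rThr
       (Write rW rI ;; Add rX rW rN ;; Write rX rB ;;
        Add rW rW rOne ;; Add rCnt rCnt rOne)
       (Const rD 0) ;;
     Add rI rI rOne).

(** All writes go to addresses from n^2 on, so each row scanned is still a row of the input. *)
Lemma collect_low_spec n p thr mat s (Q : nat -> state -> Prop) :
  reg s rN = n -> reg s rOne = 1 -> reg s rZero = 0 -> reg s rA = 0 ->
  reg s rI = 0 -> reg s rCnt = 0 -> reg s rP = p -> reg s rThr = thr ->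
  reg s rW = n * n -> ram s = mat ->
  let vs := low_rows mat n p thr n in
  (forall t s', t <= n * (5 * n + 14) + 1 ->
     agree_off [:: rA; rI; rB; rD; rJ; rV; rX; rW; rCnt] s s' ->
     reg s' rCnt = size vs ->
     (forall a, a < n * n -> ram s' a = mat a) ->
     (forall c, c < size vs -> ram s' (n * n + c) = nth 0 vs c /\
        ram s' (n * n + n + c) = nth 0 vs c * n) ->
     Q t s') ->
  runs collect_low s Q.
Proof.
move=> rn r1 rz ra0 ri0 rc0 rp rt rw0 m0 vs post.
apply: (runs_while (fun i s1 => let vs := low_rows mat n p thr i in
   [/\ agree_off [:: rA; rI; rB; rD; rJ; rV; rX; rW; rCnt] s s1,
   reg s1 rA = i * n /\ reg s1 rI = i,
   reg s1 rCnt = size vs /\ reg s1 rW = n * n + size vs,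
   forall a, a < n * n -> ram s1 a = mat a &
   forall c, c < size vs -> ram s1 (n * n + c) = nth 0 vs c /\
        ram s1 (n * n + n + c) = nth 0 vs c * n]) n (5 * n + 13)).
- by split; rewrite //= ?addn0// => a; rewrite m0.
- move=> i s1 /= [a [ra ri] [rc rw] m ml]; rewrite ri (a rN) // rn => lt_in.
  split=> //; do 3!step.
  apply: (row_sum_spec n); [by rewrite /= a|by rewrite /= a|].
  move=> t s2 le_t a2 m2 ra2 rd2.
  have eq_rd : reg s2 rD = \sum_(0 <= j < n) mat (i * n + j).
    rewrite rd2 /= ra; apply: eq_big_nat => j /andP[_ lt_jn].
    by apply: m; nia.
  have aa : agree_off [:: rA; rI; rB; rD; rJ; rV; rX; rW; rCnt] s s2.
    by apply: agree_trans a2; [apply/allP | agree].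
  do 3!step; apply: runs_if.
  rewrite /= eq_rd (a2 rP) // (a2 rThr) //= (a rP) // (a rThr) // rp rt.
  case: ifP => [low|nlow]; rewrite low_rowsS; last first.
    rewrite nlow cats0; do 2!step; split; first by lia.
    split=> //=; first agree.
    + by rewrite ra2 /= !a2 //= (a rOne) // r1 ri ra mulSn addnC addn1.
    + by rewrite !a2.
    + by rewrite m2.
    + by rewrite m2.
  rewrite low; set vs1 := low_rows _ _ _ _ _ in rc rw ml *.
  do 10!step; split; first by lia.
  (* Fewer than n vertices are listed so far, so the new list entry stays below the table of offsets
     starting at n^2 + n. *)
  have le_vs : size vs1 <= i by exact: size_low_rows.

  have eW : reg s2 rW = n * n + size vs1 by rewrite a2.
  have eN : reg s2 rN = n by rewrite a2 //= a.
  have eO : reg s2 rOne = 1 by rewrite a2 //= a.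
  have eB : reg s2 rB = i * n by rewrite a2 //= ra (a rZero) // rz addn0.
  have eI : reg s2 rI = i by rewrite a2.
  have eC : reg s2 rCnt = size vs1 by rewrite a2.
  rewrite eW eN eO eB eI eC m2 /= size_cat /= !addn1 addnS.
  split=> //; first agree.
  + by rewrite ra2 /= ra mulSn addnC.
  + move=> b lt_b; rewrite !ifN_eq ?m //; apply/eqP; lia.
  + move=> c; rewrite ltnS leq_eqVlt nth_cat => /predU1P[->|lt_c].
      rewrite ltnn subnn /= eqxx addnAC eqxx ifN_eq //; apply/eqP; lia.
    rewrite lt_c; have [<- <-] := ml c lt_c.
    rewrite !ifN_eq //; apply/eqP; lia.
- move=> i t s1 le_in le_t /= [a [ra ri] [rc rw] m ml].
  rewrite ri (a rN) // rn => le_ni.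
  have eq_in : i = n by apply/eqP; rewrite eqn_leq le_in.
  by rewrite eq_in in rc ml; apply: post => //; lia.
Qed.

Definition copy_row : prog :=
  Const rJ 0 ;;
  WhileLt rJ rCnt
    (Add rX rList rJ ;; Read rV rX ;; Add rV rV rB ;; Read rV rV ;;
     Write rW rV ;; Add rW rW rOne ;; Add rJ rJ rOne).

(** The hypothesis on sources puts them below the first address written, so no cell is overwritten
    before it is read. *)
Lemma copy_row_spec c s (Q : nat -> state -> Prop) :
  let src j := ram s (reg s rList + j) + reg s rB in
  reg s rCnt = c -> reg s rOne = 1 ->
  (forall j, j < c -> reg s rList + j < reg s rW /\ src j < reg s rW) ->
  (forall t s', t <= 8 * c + 2 ->
     agree_off [:: rX; rV; rW; rJ] s s' -> reg s' rW = reg s rW + c ->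
     (forall a, a < reg s rW -> ram s' a = ram s a) ->
     (forall j, j < c -> ram s' (reg s rW + j) = ram s (src j)) ->
     Q t s') ->
  runs copy_row s Q.
Proof.
move=> src rc r1 bound post; do 2!step.
apply: (runs_while (fun j s1 => [/\ agree_off [:: rX; rV; rW; rJ] s s1,
   reg s1 rJ = j, reg s1 rW = reg s rW + j,
   forall a, a < reg s rW -> ram s1 a = ram s a &
   forall j', j' < j -> ram s1 (reg s rW + j') = ram s (src j')]) c 7).
- by split; rewrite //= ?addn0//; agree.
- move=> j s1 [a rj rw m ml]; rewrite rj (a rCnt) // rc => lt_jc; split=> //.
  do 13!step; split=> //.
  have [lt_l lt_src] := bound j lt_jc.
  have eV : ram s1 (ram s1 (reg s1 rList + reg s1 rJ) + reg s1 rB)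
            = ram s (src j).
    by rewrite (a rList) // rj m // (a rB) // -/(src j) m.
  rewrite eV; split; rewrite /= ?rj ?rw ?(a rOne) // ?r1 ?addn1 ?addnS //.
  + agree.
  + by move=> b lt_b; rewrite ifN_eq ?m //; apply/eqP; lia.
  + move=> j'; rewrite ltnS leq_eqVlt => /predU1P[->|lt_j']; first by rewrite eqxx.
    by rewrite ifN_eq ?ml //; apply/eqP; lia.
- move=> j t s1 le_jc le_t [a rj rw m ml]; rewrite rj (a rCnt) // rc => le_cj.
  have eq_jc : j = c by apply/eqP; rewrite eqn_leq le_jc.
  by rewrite eq_jc in rw ml; apply: post => //; lia.
Qed.

Definition copy_matrix : prog :=
  WhileLt rI rCnt
    (Add rX rOff rI ;; Read rB rX ;; copy_row ;; Add rI rI rOne).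

(** The input matrix and both tables end at or below [out], so every row is copied from unchanged
    data. [rW] runs on from row to row, which makes the copy contiguous. *)
Lemma copy_matrix_spec (vs : seq nat) n s (Q : nat -> state -> Prop) :
  let c := size vs in
  let out := reg s rW in
  reg s rCnt = c -> reg s rOne = 1 -> reg s rI = 0 ->
  n * n <= out -> reg s rList + c <= out -> reg s rOff + c <= out ->
  all (ltn^~ n) vs ->
  (forall i, i < c -> ram s (reg s rList + i) = nth 0 vs i /\
     ram s (reg s rOff + i) = nth 0 vs i * n) ->
  (forall t s', t <= c * (8 * c + 6) + 1 ->
     agree_off [:: rX; rB; rV; rW; rJ; rI] s s' ->
     (forall a, a < out -> ram s' a = ram s a) ->
     (forall i j, i < c -> j < c -> ram s' (out + (i * c + j)) =
        ram s (nth 0 vs i * n + nth 0 vs j)) ->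
     Q t s') ->
  runs copy_matrix s Q.
Proof.
move=> c out rc r1 ri0 le_n le_l le_o /allP vs_lt tab post.
have lt_vs i : i < c -> nth 0 vs i < n by move=> lt_i; apply/vs_lt/mem_nth.
have lt_mat i j : i < c -> j < c -> nth 0 vs i * n + nth 0 vs j < out.
  by move=> /lt_vs lt_i /lt_vs lt_j; nia.
apply: (runs_while (fun i s1 => [/\ agree_off [:: rX; rB; rV; rW; rJ; rI] s s1,
   reg s1 rI = i, reg s1 rW = out + i * c,
   forall a, a < out -> ram s1 a = ram s a &
   forall i' j, i' < i -> j < c -> ram s1 (out + (i' * c + j)) =
        ram s (nth 0 vs i' * n + nth 0 vs j)]) c (8 * c + 5)).
- by split; rewrite //= ?addn0.
- move=> i s1 [a ri rw m ml]; rewrite ri (a rCnt) // rc => lt_ic; split=> //.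
  do 5!step.
  have eB : ram s1 (reg s1 rOff + reg s1 rI) = nth 0 vs i * n.
    by rewrite ri (a rOff) // m; [case: (tab i lt_ic) | lia].
  have eL j : j < c -> ram s1 (reg s1 rList + j) = nth 0 vs j.
    by move=> lt_j; rewrite (a rList) // m; [case: (tab j lt_j) | lia].
  apply: (copy_row_spec c) => /=.
  + by rewrite a.
  + by rewrite a.
  + move=> j lt_j; rewrite eL // eB (a rList) // rw.
    by have := lt_mat i j lt_ic lt_j; lia.
  move=> t s2 le_t a2 rw2 m2 ml2; step; split; first by lia.
  split=> /=.
  + by apply: agree_set_reg => //; apply: agree_trans a2; [apply/allP | agree].
  + by rewrite !a2 //= ri (a rOne) // r1 addn1.
  + by rewrite rw2 rw mulSn; lia.
  + by move=> b lt_b; rewrite m2 ?m // rw; lia.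
  + move=> i' j; rewrite ltnS leq_eqVlt => /predU1P[->|lt_i'] lt_j.
      by rewrite addnA -rw ml2 // eL // eB addnC m // lt_mat.
    by rewrite m2 ?ml // rw; nia.
- move=> i t s1 le_ic le_t [a ri rw m ml]; rewrite ri (a rCnt) // rc => le_ci.
  have eq_ic : i = c by apply/eqP; rewrite eqn_leq le_ic.
  by rewrite eq_ic in ml; apply: post => //; lia.
Qed.

(** Memory layout: input matrix from 0, vertex list from n^2, row offsets from n^2 + n, output
    matrix from n^2 + 2n. The address n^2 is what the first scan leaves in [rA]. *)
Definition kernel_prog : prog :=
  Const rOne 1 ;; degree_sum ;; find_p ;;
  Add rList rA rZero ;; Add rW rA rZero ;; Add rThr rN rK ;;
  Const rA 0 ;; Const rI 0 ;; collect_low ;;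
  Add rOff rList rN ;; Add rOut rOff rN ;; Add rW rOut rZero ;;
  Const rI 0 ;; copy_matrix ;;
  Add rN rCnt rZero ;; Add rK rList rZero.

Lemma kernel_prog_spec n k mat (Q : nat -> state -> Prop) :
  let tot := \sum_(0 <= i < n) \sum_(0 <= j < n) mat (i * n + j) in
  (forall t s p,
     let vs := low_rows mat n p (n + k) n in
     t <= 100 * n.+1 ^ 2 ->
     0 < p -> p * p.-1 <= n * n - n - tot < p * p.+1 ->
     reg s 0 = size vs ->
     (forall i, i < size vs -> ram s (reg s 1 + i) = nth 0 vs i) ->
     (forall i j, i < size vs -> j < size vs ->
        ram s (reg s 2 + (i * size vs + j)) =
        mat (nth 0 vs i * n + nth 0 vs j)) ->
     Q t s) ->
  runs kernel_prog
    (State (fun x => if x == 0 then n else if x == 1 then k else 0) mat) Q.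
Proof.
move=> tot post; do 3!step.
apply: (degree_sum_spec n) => // t1 s1 le_t1 a1 m1 ra1 rt1; step.
apply: (find_p_spec n);
  [by rewrite a1|by rewrite a1|by []|by rewrite a1|by rewrite a1|].
move=> t2 s2 p le_t2 a2 m2 rp2 p_gt0 p_bd.
have a12 : agree_off [:: rD; rJ; rV; rA; rTot; rI; rE; rP; rS]
    (set_reg (State (fun x => if x == 0 then n else if x == 1 then k else 0) mat)
      rOne 1) s2.
  by move=> x xl; rewrite a2 ?a1 //; apply: contra xl; apply/allP: x.
have eA : reg s2 rA = n * n by rewrite a2.
have e0 : reg s2 rN = n by rewrite a12.
have e1 : reg s2 rK = k by rewrite a12.
have e3 : reg s2 rZero = 0 by rewrite a12.
have e4 : reg s2 rOne = 1 by rewrite a12.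
have e18 : reg s2 rCnt = 0 by rewrite a12.
do 11!step; rewrite eA e0 e1 e3 addn0.
apply: (collect_low_spec n p (n + k) mat); rewrite /= ?m2 ?m1 //.
set vs := low_rows _ _ _ _ _ => t3 s3 le_t3 a3 c3 m3 ml3.
have le_vs : size vs <= n by exact: size_low_rows.
do 9!step.
have f0 : reg s3 rN = n by rewrite a3.
have f4 : reg s3 rOne = 1 by rewrite a3.
have f3 : reg s3 rZero = 0 by rewrite a3.
have f14 : reg s3 rList = n * n by rewrite a3.
rewrite f0 f3 f14 !addn0.
apply: (copy_matrix_spec vs n) => /=; rewrite ?c3 ?f14 //; try by lia.
  by apply/allP => v; rewrite mem_filter mem_iota => /andP[].
move=> t4 s4 le_t4 a4 m4 ml4; do 3!step.
have g3 : reg s4 rZero = 0 by rewrite a4.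
have g14 : reg s4 rList = n * n by rewrite a4.
have gC : reg s4 rCnt = size vs by rewrite a4.
have gO : reg s4 rOut = n * n + n + n by rewrite a4 //= addnC.
rewrite g3 g14 gC !addn0.
apply: (post _ _ p) => //=.
(* With [size vs] replaced by n, the four subprograms cost at most 18n^2 + 30n + 11 together and the
   rest is constant; the factor 100 is generous. *)
- have := leq_mul le_vs (leq_add (leq_mul (leqnn 8) le_vs) (leqnn 6)).
  move: (size vs) le_t4 => c; rewrite -mulnn => le_t4 le_c.
  move: le_t1 le_t2 le_t3 le_t4 le_c; clear; lia.
- by rewrite rt1 in p_bd.
- move=> i; rewrite -/vs => lt_i; have [<- _] := ml3 i lt_i.
  by apply: m4; lia.
- move=> i j; rewrite -/vs => lt_i lt_j; rewrite gO ml4 // m3 //.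
  have lt_vs c : c < size vs -> nth 0 vs c < n.
    by move=> /(mem_nth 0); rewrite mem_filter mem_iota => /andP[].
  by have := lt_vs i lt_i; have := lt_vs j lt_j; nia.
Qed.

(** * Degrees and independent sets *)

(** Double counting of the ordered adjacent pairs, by first entry and by underlying edge. An edge
    comes from exactly two pairs, its ends being distinct. *)
Lemma sum_degree (T : finType) (G : sgraph T) :
  \sum_v degree G v = 2 * #|edges G|.
Proof.
have -> : \sum_v degree G v = \sum_(u : T * T | adj G u.1 u.2) 1.
  rewrite -(pair_big_dep xpredT (fun v w => adj G v w) (fun _ _ => 1)) /=.
  by apply: eq_bigr => v _; rewrite sum1dep_card.
rewrite (partition_big (fun u : T * T => [set u.1; u.2]) (mem (edges G))) /=;
  last first.
  move=> [x y] /= xy; rewrite inE; apply/existsP; exists x; apply/existsP.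
  by exists y; rewrite eqxx.
rewrite mulnC -sum_nat_const; apply: eq_bigr => e; rewrite inE.
move=> /existsP[x /existsP[y /andP[/eqP -> xy]]].
have neq_xy : x != y by apply: contraTneq xy => ->; rewrite adj_irrefl.
rewrite sum1dep_card (_ : [set _ | _] = [set (x, y); (y, x)]).
  by rewrite cards2 xpair_eqE negb_and neq_xy.
apply/setP=> -[a b]; rewrite !inE !xpair_eqE; apply/andP/orP.
- move=> [ab /eqP/setP eq_ab].
  have := eq_ab a; have := eq_ab b; rewrite !inE !eqxx orbT /=.
  have neq_ab : a != b by apply: contraTneq ab => ->; rewrite adj_irrefl.
  move=> /esym/orP[/eqP bx|/eqP by_] /esym/orP[/eqP ax|/eqP ay].
  + by rewrite bx ax eqxx in neq_ab.
  + by right; rewrite ay bx !eqxx.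
  + by left; rewrite ax by_ !eqxx.
  + by rewrite ay by_ eqxx in neq_ab.
- move=> [/andP[/eqP -> /eqP ->]|/andP[/eqP -> /eqP ->]] //.
  by rewrite adj_sym finset.setUC.
Qed.

Lemma degree_lt (T : finType) (G : sgraph T) v : degree G v < nvertices G.
Proof.
apply: proper_card; apply/properP; split; first exact/fintype.subsetP.
by exists v; rewrite // inE adj_irrefl.
Qed.

Lemma sum_codegree (T : finType) (G : sgraph T) :
  \sum_v ((nvertices G).-1 - degree G v)
  = nvertices G * nvertices G - nvertices G - 2 * #|edges G|.
Proof.
rewrite -sum_degree sumnB; last by move=> v _; have := degree_lt _ G v; lia.
by rewrite sum_nat_const -subn1 mulnBr muln1.
Qed.

(** Completing the square turns p(p-1) <= d < p(p+1) into (p - 1/2)^2 <= 1/4 + d < (p + 1/2)^2, and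
    taking roots gives the floor. *)
Lemma p_of_eq (R : realType) (T : finType) (G : sgraph T) (p : nat) :
  0 < p ->
  p * p.-1 <= nvertices G * nvertices G - nvertices G - 2 * #|edges G|
    < p * p.+1 ->
  p_of R G = p.
Proof.
move=> p_gt0; set d := (X in _ <= X < _) => /andP[le_pd lt_dp].
have le_2m : 2 * #|edges G| <= nvertices G * nvertices G - nvertices G.
  have -> : nvertices G * nvertices G - nvertices G
            = \sum_(v : T) (nvertices G).-1.
    by rewrite sum_nat_const -subn1 mulnBr muln1.
  rewrite -sum_degree; apply: leq_sum => v _.
  by have := degree_lt _ G v; lia.
have le_n : nvertices G <= nvertices G * nvertices G by nia.
(* By [le_2m] and [le_n] neither subtraction in [d] truncates, so [d] casts to the real
   difference. *)
rewrite /p_of (_ : (1 / 4 + _ - _ - _)%R = 1 / 4 + d%:R :> R)%R; last first.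
  by rewrite /d natrB // natrB // natrM natrM expr2 !addrA.
apply: truncn_def; apply/andP; split.
- have le_pd' : (p%:R * (p%:R - 1) <= d%:R :> R)%R.
    by rewrite -(natrB _ p_gt0) subn1 -natrM ler_nat.
  have p_ge1 : (1 <= p%:R :> R)%R by rewrite ler1n.
  have : (p%:R - 1 / 2 <= Num.sqrt (1 / 4 + d%:R) :> R)%R.
    rewrite -[leLHS]ger0_norm; last by lra.
    by rewrite -sqrtr_sqr ler_sqrt; nra.
  lra.
- have lt_dp' : (d%:R < p%:R * (p%:R + 1) :> R)%R.
    by rewrite natr1 -natrM ltr_nat.
  have p_ge0 := ler0n R p.
  have : (Num.sqrt (1 / 4 + d%:R) < p%:R + 1 / 2 :> R)%R.
    rewrite -[ltRHS]ger0_norm; last by lra.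
    by rewrite -sqrtr_sqr ltr_sqrt; nra.
  rewrite -natr1; lra.
Qed.

(** This identifies the integer threshold with the subtraction-free test made by the machine. *)
Lemma low_degreeE (T : finType) (G : sgraph T) (p k : nat) v :
  (v \in low_degree G p k) = (degree G v + p < nvertices G + k).
Proof. by rewrite !inE; lia. Qed.

Lemma card_low_degree (T : finType) (G : sgraph T) (p k : nat) :
  2 * k + 1 <= p ->
  nvertices G * nvertices G - nvertices G - 2 * #|edges G| < p * p.+1 ->
  #|low_degree G p k| <= p + 2 * k + 1.
Proof.
rewrite -sum_codegree => le_kp lt_d.
have : #|low_degree G p k| * (p - k) < p * p.+1.
  apply: leq_ltn_trans lt_d.
  rewrite -sum_nat_const [leqRHS](bigID (mem (low_degree G p k))) /=.
  apply: leq_trans (leq_addr _ _); apply: leq_sum => v.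
  by rewrite low_degreeE; lia.
by move=> lt_low; nia.
Qed.

Lemma independentP (T : finType) (G : sgraph T) (S : {set T}) :
  reflect {in S &, forall x y, ~~ adj G x y} (independent G S).
Proof.
apply: (iffP forall_inP) => [h x y xS yS|h x xS].
  by have /forall_inP := h x xS; exact.
by apply/forall_inP => y yS; exact: h.
Qed.

Lemma alpha_leP (T : finType) (G : sgraph T) (m : nat) :
  reflect (forall S, independent G S -> #|S| <= m) (alpha G <= m).
Proof. exact: bigmax_leqP. Qed.

Lemma alpha_low_degree (T : finType) (G : sgraph T) (p k : nat) :
  alpha G <= p - k <-> alpha (Gpk G p k) <= p - k.
Proof.
split=> /alpha_leP le_m; apply/alpha_leP => S /independentP indS.
  rewrite -(card_imset _ val_inj); apply: le_m; apply/independentP.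
  by move=> _ _ /imsetP[x xS ->] /imsetP[y yS ->]; exact: (indS x y).
rewrite leqNgt; apply/negP => lt_S.
have low v : v \in S -> v \in low_degree G p k.
  move=> vS; rewrite low_degreeE.
  (* All neighbours of [v] lie outside the independent set [S], and [S] has more than p - k
     elements. *)
  suff : degree G v + #|S| <= nvertices G by lia.
  rewrite /nvertices -(cardsC S) addnC leq_add2l; apply: subset_leq_card.
  apply/fintype.subsetP => w; rewrite !inE; apply: contraTN.
  exact: indS.
move: lt_S; rewrite ltnNge => /negP; apply.
have <- : val @: [set u : {v | v \in low_degree G p k} | val u \in S] = S.
  apply/setP => v; apply/imsetP/idP => [[u + ->]|vS]; first by rewrite inE.
  by exists (eqtype.Sub v (low v vS)); rewrite ?inE.
rewrite (card_imset _ val_inj); apply: le_m; apply/independentP => x y.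
by rewrite !inE; exact: indS.
Qed.

(** * Correctness and quadratic time on the encoded graph *)

(** Division by n recovers i and j from i * n + j, so only one pair can witness the existential that
    defines the memory cell. *)
Lemma input_ramE (n : nat) (G : sgraph 'I_n) k (i j : 'I_n) :
  ram (input_state G k) (i * n + j) = adj G i j.
Proof.
rewrite /=; congr (nat_of_bool _); apply/existsP/idP => [[i' /existsP[j']]|ij].
  case/andP=> /eqP eq_a ij'.
  have n_gt0 : 0 < n by exact: leq_ltn_trans (ltn_ord i).
  have eq_i : i = i'.
    apply: val_inj; have := congr1 (divn^~ n) eq_a.
    by rewrite !divnMDl // !divn_small // !addn0.
  have eq_j : j = j'.
    by apply: val_inj; apply/eqP; rewrite -(eqn_add2l (i * n)) eq_a eq_i.
  by rewrite eq_i eq_j.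
by exists i; apply/existsP; exists j; rewrite eqxx.
Qed.

Lemma input_row_sum (n : nat) (G : sgraph 'I_n) k (i : 'I_n) :
  \sum_(0 <= j < n) ram (input_state G k) (i * n + j) = degree G i.
Proof.
rewrite big_mkord /degree -sum1dep_card [RHS]big_mkcond.
by apply: eq_bigr => j _; rewrite (input_ramE _ G k); case: adj.
Qed.

Local Open Scope classical_set_scope.
Local Open Scope nat_scope.

Theorem theorem4 (R : realType) :
  exists (algo : prog) (time : nat -> nat),
    ((fun n : nat => (time n)%:R : R) =O_\oo (fun n : nat => (n ^ 2)%:R : R))%R
    /\
    forall (n k : nat) (G : sgraph 'I_n),
      let p := p_of R G in
      2 * k + 1 <= p ->
      exists (t : nat) (s : state),
        [/\ exec algo (input_state G k) t s,
            t <= time n,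
            returns_induced s G (low_degree G p k),
            nvertices (Gpk G p k) <= p + 2 * k + 1
          & alpha G <= p - k <-> alpha (Gpk G p k) <= p - k].
Proof.
exists kernel_prog, (fun n => 100 * n.+1 ^ 2); split.
  apply/eqOP; near=> C; near=> n.
  have n_gt0 : 0 < n by near: n; exists 1.
  rewrite !ger0_norm ?ler0n//.
  (* For n >= 1, n + 1 <= 2n, hence 100(n+1)^2 <= 400n^2; [C] is taken at least 400. *)
  apply: (@le_trans _ _ (400%:R * (n ^ 2)%:R)%R).
    by rewrite -natrM ler_nat -!mulnn; nia.
  by rewrite ler_wpM2r.
move=> n k G p le_kp.
(* The bound d < p(p+1), found by the loop that computes p, is carried out of the run because it
   bounds n_0. *)
suff [t [s [ex [le_t ret p_bd]]]] : runs kernel_prog (input_state G k)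
    (fun t s => [/\ t <= 100 * n.+1 ^ 2, returns_induced s G (low_degree G p k) &
       nvertices G * nvertices G - nvertices G - 2 * #|edges G| < p * p.+1]).
  exists t, s; split=> //; last exact: alpha_low_degree.
  by rewrite /nvertices card_sig card_low_degree.
apply: (kernel_prog_spec n k (ram (input_state G k))) => t s q vs le_t q_gt0.
rewrite big_mkord (eq_bigr _ (fun i _ => input_row_sum _ G k i)) sum_degree.
rewrite -[n in n * n - n](card_ord n) => q_bd r_size r_list r_mat.
have eq_q : q = p by rewrite /p (p_of_eq _ _ _ q).
subst q; split=> //; last by case/andP: q_bd.
(* The machine lists vertices as numbers; [ws] is the same increasing list in ['I_n]. *)
pose ws := [seq v <- enum 'I_n | v \in low_degree G p k].
have eq_vs : vs = map val ws.
  rewrite /vs /low_rows -val_enum_ord filter_map; congr map.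
  apply: eq_filter => v /=; rewrite low_degreeE /nvertices card_ord.
  by rewrite (input_row_sum _ G k).
rewrite eq_vs size_map in r_size r_list r_mat.
have nthE v0 i : i < size ws -> nth 0 (map val ws) i = nth v0 ws i.
  exact: nth_map.
exists ws; split=> //.
- by rewrite filter_uniq // enum_uniq.
- by move=> v; rewrite mem_filter mem_enum andbT.
- by move=> v0 i lt_i; rewrite r_list // (nthE v0).
- move=> v0 i j lt_i lt_j; rewrite r_mat // !(nthE v0) //.
  exact: (input_ramE _ G k).
Unshelve. all: by end_near.
Qed.
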